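(* Let $k\ge 2$ and let $f^s_{k,n}$, $l^i_{k,n}$ ($1\le s,i\le k$, $n\in\mathbb{Z}$) be as in the context. Then for all integers $m,n$ and every $1\le i\le k-1$, $$l^i_{k,n+m}=\sum_{j=1}^{i}\Big(l^k_{k,m-j}\sum_{s=1}^{j}f^s_{k,n}\Big)+\sum_{j=i+1}^{k}\Big(l^k_{k,m-j}\sum_{s=j-i+1}^{j}f^s_{k,n}\Big)+\sum_{j=k+1}^{k+i-1}\Big(l^k_{k,m-j}\sum_{s=j-i+1}^{k}f^s_{k,n}\Big),$$ where a sum whose lower index exceeds its upper index is zero.
   Context: $k$ sequences of generalized order-$k$ Fibonacci numbers: for $1\le i\le k$, $f^i_{k,n}=1$ if $1-k\le n\le 0$ and $i=1-n$, $f^i_{k,n}=0$ if $1-k\le n\le 0$ and $i\neq 1-n$, and $f^i_{k,n}=\sum_{j=1}^k f^i_{k,n-j}$ for $n\ge 1$. $k$ sequences of generalized order-$k$ Lucas numbers: for $1\le i\le k$ and $1-k\le n\le 0$, $l^i_{k,n}=-i$ if $i-n<k$, $l^i_{k,n}=i-2n$ if $i-n=k$, $l^i_{k,n}=k-i-1$ if $i-n>k$; and $l^i_{k,n}=\sum_{j=1}^k l^i_{k,n-j}$ for $n\ge 1$. All these sequences are extended to all integers $n$ by requiring their recurrence $x_n=\sum_{j=1}^k x_{n-j}$ to hold for all $n\in\mathbb{Z}$. *)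

(* Defs.v *)
From mathcomp Require Import all_boot all_order all_algebra zify.
Set Implicit Arguments.
Unset Strict Implicit.
Unset Printing Implicit Defensive.
Import Order.TTheory GRing.Theory Num.Theory.
Local Open Scope ring_scope.

(* The two-sided recurrence x_n = x_(n-1) + ... + x_(n-k), for all n in Z. *)
Definition order_rec (k : nat) (x : int -> int) : Prop :=
  forall n : int, x n = \sum_(1 <= j < k.+1) x (n - j%:Z).

Definition fib_init (k i : nat) (n : int) : int :=
  if i%:Z == 1 - n then 1 else 0.

Definition lucas_init (k i : nat) (n : int) : int :=
  if i%:Z - n < k%:Z then - i%:Z
  else if i%:Z - n == k%:Z then i%:Z - 2 * n
  else k%:Z - i%:Z - 1.

(* [x i n] stands for x^i_(k,n); only the superscripts 1 <= i <= k are
   constrained. The initial values on 1-k <= n <= 0 and the recurrence determine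
   x^i uniquely on Z. *)
Definition gen_seqs (init : nat -> nat -> int -> int) (k : nat)
    (x : nat -> int -> int) : Prop :=
  forall i : nat, (1 <= i <= k)%N ->
    (forall n : int, 1 - k%:Z <= n <= 0 -> x i n = init k i n) /\
    order_rec k (x i).

Definition gen_fib : nat -> (nat -> int -> int) -> Prop := gen_seqs fib_init.

Definition gen_lucas : nat -> (nat -> int -> int) -> Prop := gen_seqs lucas_init.

Lemma order_rec_ext (k : nat) (a : int -> int) : (0 < k)%N ->
  exists x : int -> int,
    (forall n : int, 1 - k%:Z <= n <= 0 -> x n = a n) /\ order_rec k x.
Proof.
move=> k0.
pose fwd (v : nat -> int) j := if j is j'.+1 then v j' else \sum_(0 <= t < k) v t.
pose bwd (v : nat -> int) j :=
  if j.+1 == k then v 0%N - \sum_(1 <= t < k) v t else v j.+1.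
pose v0 j := a (- j%:Z).
pose st (n : int) := match n with
  | Posz m => iter m fwd v0 | Negz m => iter m.+1 bwd v0 end.
have fb v j : (j < k)%N -> fwd (bwd v) j = v j.
  case: j => [_|j jk]; last first.
    by rewrite /fwd /bwd; case: eqP => // e; move: jk; rewrite e ltnn.
  rewrite /fwd; case: k k0 @bwd {fwd st} => // k _ bwd.
  rewrite big_nat_recr //= /bwd eqxx big_add1 /=.
  rewrite (@eq_big_nat _ _ _ 0 k _ (fun t => v t.+1)) ?subrKC //.
  by move=> t /andP[_ tk]; rewrite eqSS ltn_eqF.
have stS n j : (j < k)%N -> st (n + 1) j = fwd (st n) j.
  move=> jk; case: n => m.
    have -> : Posz m + 1 = Posz m.+1 by lia.
    by [].
  have -> : st (Negz m + 1) = iter m bwd v0.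
    case: m => [|m]; first by have -> : Negz 0 + 1 = Posz 0 by lia.
    by have -> : Negz m.+1 + 1 = Negz m by lia.
  by symmetry; exact: (fb (iter m bwd v0)).
have stE j : (j < k)%N -> forall n, st n j = st (n - j%:Z) 0%N.
  elim: j => [_ n|j IH jk n]; first by rewrite subr0.
  have -> : n = (n - 1) + 1 by lia.
  rewrite stS //= IH; last exact: ltnW.
  by congr (st _ 0%N); lia.
exists (fun n => st n 0%N); split=> [n nk|n].
  have [j jn] : exists j : nat, n = 0 - j%:Z by exists `|n|%N; lia.
  have jk : (j < k)%N by lia.
  by rewrite jn -stE //= /v0 sub0r.
have -> : n = (n - 1) + 1 by lia.
rewrite stS //= big_add1 /=.
apply: eq_big_nat => t /andP[_ tk].
by rewrite stE //; congr (st _ 0%N); lia.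
Qed.

Lemma gen_seqs_exists (init : nat -> nat -> int -> int) (k : nat) :
  exists x : nat -> int -> int, gen_seqs init k x.
Proof.
have [-> |k0] := posnP k; first by exists (fun _ _ => 0) => i; lia.
have P i := order_rec_ext (init k i) k0.
have [x xP] : exists x : nat -> int -> int,
    forall i, (i < k.+1)%N ->
    (forall n : int, 1 - k%:Z <= n <= 0 -> x i n = init k i n) /\
    order_rec k (x i).
  elim: k.+1 => [|K [x IH]]; first by exists (fun _ _ => 0).
  have [y yP] := P K.
  exists (fun i => if i == K then y else x i) => i.
  case: eqP => [-> _|ne iK]; first exact: yP.
  by apply: IH; lia.
by exists x => i /andP[_ ik]; apply: xP.
Qed.

(* Main.v *)
Require Import Defs.
From mathcomp Require Import all_boot all_order all_algebra.
From mathcomp Require Import zify ring.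
Import GRing.Theory.
Local Open Scope ring_scope.

(** A solution of the two-sided recurrence is determined by its values on the
    window [1 - k <= n <= 0]. Comparing initial values gives
    [l^i_n = l^k_(n-1) + ... + l^k_(n-i)] for [i < k] and, since the [f^s] are
    the unit vectors on the window, [x_(n+m) = \sum_s f^s_n x_(m+1-s)] for every
    solution [x]. Expanding [l^i_(n+m)] by both formulas yields a double sum of
    [f^s_n l^k_(m+1-s-t)], which is regrouped according to [j = s + t - 1]. *)

(** Zeros spread from the window in both directions: induction on [N] widens it to
    [1 - k - N <= p <= N]. The new right end comes from the recurrence at [N + 1], the new left end
    from the recurrence at [- N], solved for its last term. *)
Lemma order_rec_window_eq0 (k : nat) (d : int -> int) : (0 < k)%N ->
  order_rec k d -> (forall n : int, 1 - k%:Z <= n <= 0 -> d n = 0) ->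
  forall n, d n = 0.
Proof.
move=> k0 rd d0 n.
suff H (N : nat) : forall p : int, 1 - k%:Z - N%:Z <= p <= N%:Z -> d p = 0.
  by apply: (H `|n|%N); lia.
elim: N => [|N IH] p hp; first by apply: d0; lia.
have [pN|pN] := boolP (p == N.+1%:Z).
  rewrite rd big_nat_cond big1 // => j hj; apply: IH; lia.
have [pk|pk] := boolP (p == - k%:Z - N%:Z); last by apply: IH; lia.
have := rd (- N%:Z); rewrite big_nat_recr //= big_nat_cond big1; last first.
  by move=> j hj; apply: IH; lia.
rewrite IH ?add0r; last lia.
by move=> ->; congr d; lia.
Qed.

Lemma order_rec_unique (k : nat) (x y : int -> int) : (0 < k)%N ->
  order_rec k x -> order_rec k y ->
  (forall n : int, 1 - k%:Z <= n <= 0 -> x n = y n) -> forall n, x n = y n.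
Proof.
move=> k0 rx ry xy n; apply/eqP; rewrite -subr_eq0; apply/eqP.
apply: (@order_rec_window_eq0 k (fun n => x n - y n)) => // [p|p hp].
  by rewrite sumrB -rx -ry.
by rewrite xy // subrr.
Qed.

Lemma order_rec_shift (k : nat) (x : int -> int) (m : int) :
  order_rec k x -> order_rec k (fun n => x (n + m)).
Proof.
by move=> rx n; rewrite rx; apply: eq_bigr => j _; congr x; lia.
Qed.

Lemma order_rec_sum (k a b : nat) (x : nat -> int -> int) (c : nat -> int) :
  (forall s, (a <= s < b)%N -> order_rec k (x s)) ->
  order_rec k (fun n => \sum_(a <= s < b) x s n * c s).
Proof.
move=> rx n; rewrite exchange_big /=; apply: eq_big_nat => s hs.
by rewrite rx // mulr_suml.
Qed.

(** Subtracting the recurrences at [n + 1] and [n] telescopes to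
    [x (n + 1) - x n = x n - x (n - k)], a backward step free of sums. *)
Lemma order_rec_step (k : nat) (x : int -> int) (n : int) :
  (0 < k)%N -> order_rec k x -> x (n - k%:Z) = 2 * x n - x (n + 1).
Proof.
case: k => // k _ rx; rewrite (rx (n + 1)) big_nat_recl // big_add1 /=.
have -> : n + 1 - 1 = n by lia.
rewrite [in 2 * _]rx big_nat_recr //=.
set S := \sum_(1 <= j < k.+1) _.
have -> : \sum_(0 <= j < k) x (n + 1 - j.+2%:Z) = S.
  by rewrite /S big_add1 /=; apply: eq_bigr => j _; congr x; lia.
rewrite {1}(rx n) big_nat_recr //= -/S; ring.
Qed.

Lemma gen_fib_expand {k : nat} {f : nat -> int -> int} {x : int -> int} :
  (0 < k)%N -> gen_fib k f -> order_rec k x -> forall m n : int,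
  x (n + m) = \sum_(1 <= s < k.+1) f s n * x (m + 1 - s%:Z).
Proof.
move=> k0 hf rx m.
apply: (@order_rec_unique k (fun n => x (n + m))) => //.
- exact: order_rec_shift.
- by apply: order_rec_sum => s hs; have [] := hf s hs.
(* On the window [1 - n] is a valid superscript, and the only one whose [f s n] is nonzero. *)
move=> n hn; pose s0 := `|1 - n|%N.
rewrite (bigD1_seq s0) ?iota_uniq ?mem_index_iota //=; last by rewrite /s0; lia.
rewrite big_nat_cond big1 => [|s hs]; last first.
  have [-> // _] := hf s ltac:(lia).
  rewrite /fib_init ifF ?mul0r //; rewrite /s0 in hs; lia.
have [-> // _] := hf s0 ltac:(rewrite /s0; lia).
by rewrite /fib_init ifT ?mul1r ?addr0; [congr x|]; rewrite /s0; lia.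
Qed.

(** Explicit values one period below the window, since the indices [n - t] with [n] in the window
    and [t < k] reach that far down. *)
Lemma gen_lucas_last (k : nat) (l : nat -> int -> int) (n : int) :
  (2 <= k)%N -> gen_lucas k l -> 1 - 2 * k%:Z <= n <= 0 ->
  l k n = if n == 0 then k%:Z else if n == - k%:Z then 2 * k%:Z - 1
          else if n == - k%:Z - 1 then - k%:Z - 2 else -1.
Proof.
move=> hk hl.
have [l0 rl] := hl k ltac:(lia).
have lw (p : int) : 1 - k%:Z <= p <= 0 -> l k p = if p == 0 then k%:Z else -1.
  by move=> hp; rewrite l0 // /lucas_init; do !case: ifP => ?; lia.
(* The recurrence at 0 reads [k = - (k - 1) + l k (- k)]. *)
have lk : l k (- k%:Z) = 2 * k%:Z - 1.
  have := rl 0; rewrite lw; last lia.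
  rewrite big_nat_recr /=; last lia.
  rewrite (@eq_big_nat _ _ _ 1 k _ (fun=> -1)); last first.
    by move=> j hj; rewrite lw ?ifF; lia.
  rewrite sumr_const_nat mulNrn (natz (k - 1)) sub0r.
  by move: (l k _) => g; lia.
move=> hn; have [nk|nk] := boolP (1 - k%:Z <= n).
  by rewrite lw; [do !case: ifP => ?; lia | lia].
have [->|nk'] := eqVneq n (- k%:Z).
  by rewrite lk; do !case: ifP => ?; lia.
have -> : n = (n + k%:Z) - k%:Z by lia.
rewrite order_rec_step ?lw //; [do !case: ifP => ?; lia | lia..].
Qed.

Lemma gen_lucas_sum_last {k : nat} {l : nat -> int -> int} {i : nat} (n : int) :
  (2 <= k)%N -> gen_lucas k l -> (1 <= i <= k - 1)%N ->
  l i n = \sum_(1 <= t < i.+1) l k (n - t%:Z).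
Proof.
move=> hk hl hi.
have [li ri] := hl i ltac:(lia).
have [_ rk] := hl k ltac:(lia).
apply: (@order_rec_unique k _ (fun n => \sum_(1 <= t < i.+1) l k (n - t%:Z)));
  [lia | exact: ri | | ].
  move=> p; rewrite exchange_big /=; apply: eq_bigr => t _.
  by rewrite rk; apply: eq_bigr => j _; congr (l k); lia.
move=> p hp; rewrite li // {li ri}.
(* Without [1 <= i] the induction can start at [i = 0], where [lucas_init] vanishes on the window,
   like the empty sum. *)
have {hi} : (i <= k - 1)%N by lia.
elim: i => [|i IH] hi.
  by rewrite big_geq // /lucas_init; do !case: ifP => ?; lia.
rewrite big_nat_recr //= -IH; last lia.
rewrite (gen_lucas_last k l) //; last lia.
by rewrite /lucas_init; do !case: ifP => ?; lia.
Qed.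

Lemma sum_nat_filter {a b a' b' : nat} {F : nat -> int} :
  (a <= a')%N -> (b' <= b)%N ->
  \sum_(a' <= s < b') F s = \sum_(a <= s < b | (a' <= s < b')%N) F s.
Proof.
move=> ha hb; rewrite (big_nat_widen _ _ _ _ _ hb) (big_nat_widenl _ _ _ _ _ ha).
by apply: eq_bigl => s; rewrite /= andbC.
Qed.

Theorem theorem2p12 (k : nat) (f l : nat -> int -> int)
  (hk : (2 <= k)%N) (hf : gen_fib k f) (hl : gen_lucas k l)
  (m n : int) (i : nat) (hi : (1 <= i <= k - 1)%N) :
  l i (n + m) =
    \sum_(1 <= j < i.+1) (l k (m - j%:Z) * \sum_(1 <= s < j.+1) f s n)
  + \sum_(i.+1 <= j < k.+1)
      (l k (m - j%:Z) * \sum_((j - i).+1 <= s < j.+1) f s n)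
  + \sum_(k.+1 <= j < k + i)
      (l k (m - j%:Z) * \sum_((j - i).+1 <= s < k.+1) f s n).
Proof.
have [_ ri] := hl i ltac:(lia).
(* The condition says that [t = j - s + 1] lies in [1..i]. Clipped to [1 <= s <= k], it gives the
   three inner ranges of the statement. *)
pose G j := \sum_(1 <= s < k.+1)
  if (s <= j < s + i)%N then l k (m - j%:Z) * f s n else 0.
have GE a b j : (1 <= a)%N -> (b <= k.+1)%N ->
    (forall s, (1 <= s < k.+1)%N -> (a <= s < b)%N = (s <= j < s + i)%N) ->
    l k (m - j%:Z) * \sum_(a <= s < b) f s n = G j.
  move=> ha hb e; rewrite (sum_nat_filter ha hb) mulr_sumr big_mkcond.
  by apply: eq_big_nat => s hs; rewrite e.
rewrite (@eq_big_nat _ _ _ 1 i.+1 _ G); last by move=> j hj; apply: GE; lia.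
rewrite (@eq_big_nat _ _ _ i.+1 k.+1 _ G); last by move=> j hj; apply: GE; lia.
rewrite (@eq_big_nat _ _ _ k.+1 (k + i) _ G); last first.
  by move=> j hj; apply: GE; lia.
rewrite -!big_cat_nat /=; [|lia..].
rewrite (gen_fib_expand _ hf ri); last lia.
(* For fixed [s], the indices [s <= j < s + i] all lie in the joined range [1 <= j < k + i]. *)
rewrite exchange_big /=; apply: eq_big_nat => s hs.
rewrite -big_mkcond -sum_nat_filter; [|lia..].
rewrite (gen_lucas_sum_last _ hk hl hi) mulr_sumr big_add1 /=.
rewrite -[X in index_iota X (s + i)]add0n big_addn addKn.
apply: eq_bigr => t _; rewrite mulrC; congr (l k _ * _); lia.
Qed.
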